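(* Let $n$ be a positive integer such that $p=18(2n+1)^2+1$ is prime. Then for every primitive root $g$ of $\mathbb F_p$, $$(-1)^{|\tau_g|}=(-1)^{n+1}.$$
   Context: Let $p$ be an odd prime, $\mathbb F_p$ the field with $p$ elements, identified with $\{0,1,\ldots,p-1\}$, and $\mathcal H_p=\{1,2,\ldots,(p-1)/2\}\subseteq\mathbb F_p$. For a primitive root $g$ of $\mathbb F_p$, $\tau_g$ is the permutation of $\mathcal H_p$ given by $\tau_g(b)=g^b$ if $g^b\in\mathcal H_p$ and $\tau_g(b)=-g^b$ if $g^b\notin\mathcal H_p$ (for $b\in\mathcal H_p$). For a permutation $\pi$, $(-1)^{|\pi|}$ denotes its sign. *)

(* Defs.v *)
From mathcomp Require Import all_boot all_order all_algebra all_fingroup.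
Set Implicit Arguments. Unset Strict Implicit. Unset Printing Implicit Defensive.
Import GRing.Theory.

(* H_p = {1,...,(p-1)/2}; we index it by 'I_(half p), the ordinal i
   standing for the element b = i+1 of H_p. *)
Definition half (p : nat) : nat := (p.-1)./2.

Lemma ord_pos (n : nat) (i : 'I_n) : 0 < n.
Proof. exact: leq_ltn_trans (leq0n i) (ltn_ord i). Qed.

Definition tau_val (p : nat) (g : 'F_p) (b : nat) : nat :=
  let x := nat_of_ord (g ^+ b)%R in
  if x <= half p then x else p - x.

(* tau_g as a function 'I_(half p) -> 'I_(half p) (b = i+1 |-> tau_g(b) - 1;
   the final "%% half p" is a no-op whenever tau_g(b) lies in H_p). *)
Definition tau_fun (p : nat) (g : 'F_p) (i : 'I_(half p)) : 'I_(half p) :=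
  Ordinal (ltn_pmod (tau_val g i.+1).-1 (ord_pos i)).

(* The permutation tau_g (identity as a junk value if tau_fun is not injective;
   the main statement asserts injectivity separately). *)
Definition tau_perm (p : nat) (g : 'F_p) : {perm 'I_(half p)} :=
  match injectiveb (tau_fun g) as b return injectiveb (tau_fun g) = b -> _ with
  | true => fun H => perm (injectiveP _ H)
  | false => fun _ => 1%g
  end erefl.

(* Main.v *)
(* Write p = 2h + 1 with h = s^2, s = 3(2n + 1).  Since tau_g(b)^2 = g^(2b),
   comparing the Vandermonde determinants at the points b^2 and tau_g(b)^2
   gives, in F_p and with products over 1 <= i < j <= h,
     sign(tau_g) * prod (j^2 - i^2) = prod (z^j - z^i),   z = g^2.
   The left product is 1 by Wilson's theorem.  As h is odd, the sign is
   unchanged by the Legendre character x |-> x^h, which sends the right product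
   to prod_(1 <= e <= (h-1)/2) C(e), where C(e) = (z^(2e) - 1)^h = +-1.
   Now C is odd modulo h, and C(a) C(a+s) ... C(a+(s-1)s) = C(sa) because z^(2s)
   is a primitive s-th root of unity; arranging the range in rows modulo s
   shows that the product is (-1)^((s-1)/2) = (-1)^(3n+1). *)

From mathcomp Require Import all_boot all_order all_algebra all_fingroup.
From mathcomp Require Import cyclotomic finfield zify ring.
Require Import Defs.

Set Implicit Arguments.
Unset Strict Implicit.
Unset Printing Implicit Defensive.

Import GRing.Theory.
Local Open Scope ring_scope.

(** * Products of signs over triangles and blocks *)

(** The factor [c d] occurs once for each j from d to 2k, hence an odd number of times exactly when
    d is even. *)
Lemma prod_triangle_sqr1 (R : comNzRingType) (c : nat -> R) (k : nat) :
    (forall d, (0 < d < k.*2.+1)%N -> c d ^+ 2 = 1) ->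
  \prod_(0 <= j < k.*2.+1) \prod_(1 <= d < j.+1) c d
    = \prod_(1 <= e < k.+1) c e.*2.
Proof.
elim: k => [|k IHk] c2; first by rewrite big_nat1 !big_geq.
rewrite doubleS 2?big_nat_recr //= IHk; last by move=> d ?; apply: c2; lia.
rewrite [in RHS]big_nat_recr //= doubleS -mulrA; congr (_ * _).
rewrite [X in _ * X]big_nat_recr //= mulrA -expr2 -prodrXl big_nat.
by rewrite big1 ?mul1r // => d ?; apply: c2; lia.
Qed.

Lemma prod_block (R : comNzRingType) (C : nat -> R) (r m : nat) : (r <= m)%N ->
  \prod_(m - r <= e < m + r.+1) C e
    = C m * \prod_(1 <= a < r.+1) (C (m + a)%N * C (m - a)%N).
Proof.
elim: r => [|r IHr] ler.
  by rewrite subn0 addn1 big_nat1 big_geq // mulr1.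
rewrite [in RHS]big_nat_recr //= mulrA -IHr; last by lia.
rewrite [X in index_iota _ X]addnS big_nat_recr /=; last by lia.
rewrite big_ltn; last by lia.
have -> : (m - r.+1).+1 = (m - r)%N by lia.
by ring.
Qed.

(* Every e in [1, (s^2-1)/2] is s * b + a with |a| <= r and 0 <= b <= r.
   Replacing C (s * b - a) by - C (a - s * b) costs (-1) ^+ (r * r), and the
   rows b = -r, ..., r then multiply out to C (s * a); what remains is
   the square of the product of the C (s * a). *)
Lemma prod_half_square (R : comNzRingType) (C : nat -> R) (r : nat)
    (s := r.*2.+1) :
    (forall e, (0 < e < s * s)%N -> C e ^+ 2 = 1) ->
    (forall e, (0 < e < s * s)%N -> C (s * s - e)%N = - C e) ->
    (forall a, (0 < a < s)%N ->
      \prod_(0 <= b < s) C (a + s * b)%N = C (s * a)%N) ->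
  \prod_(1 <= e < (r * r.+1).*2.+1) C e = (-1) ^+ r.
Proof.
move=> C2 Codd Cmul.
have blocks t : \prod_(1 <= e < r.+1 + s * t) C e
    = \prod_(1 <= a < r.+1) C a * \prod_(1 <= b < t.+1)
      (C (s * b)%N * \prod_(1 <= a < r.+1) (C (s * b + a)%N * C (s * b - a)%N)).
  elim: t => [|t IHt]; first by rewrite muln0 addn0 [X in _ * X]big_geq ?mulr1.
  rewrite [X in _ * X]big_nat_recr //= mulrA -IHt -prod_block; last by lia.
  rewrite (@big_cat_nat _ _ _ (r.+1 + s * t)) /=; try lia.
  by congr (_ * _); congr bigop; congr index_iota; lia.
have -> : (r * r.+1).*2.+1 = (r.+1 + s * r)%N by lia.
rewrite blocks big_split /= exchange_big_nat mulrCA -big_split /=.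
have row a : (0 < a < r.+1)%N ->
    C a * \prod_(1 <= b < r.+1) (C (s * b + a)%N * C (s * b - a)%N)
      = (-1) ^+ r * C (s * a)%N.
  move=> ha; rewrite -Cmul; last by lia.
  rewrite [in RHS]big_ltn // muln0 addn0.
  rewrite [in RHS](@big_cat_nat _ _ _ r.+1) //=; last by lia.
  rewrite mulrCA; congr (_ * _); rewrite big_split /= mulrCA; congr (_ * _).
    by apply: eq_bigr => b _; rewrite addnC.
  (* The rows b and s - b are matched: a + s(s - b) = s*s - (s b - a), so [Codd] gives one sign for
     each of the r values of b. *)
  rewrite -[r.+1 in RHS]add1n [in RHS]big_addn [in LHS] big_nat_rev /=.
  have -> : (s - r)%N = r.+1 by lia.
  have <- : \prod_(1 <= b < r.+1) (-1 : R) = (-1) ^+ r.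
    by rewrite prodr_const_nat subn1.
  rewrite -big_split /=.
  apply: eq_big_nat => b hb.
  rewrite mulN1r -Codd; last by nia.
  by congr C; nia.
rewrite (eq_big_nat _ _ row) big_split /= mulrCA -expr2 -prodrXl.
rewrite [X in _ * X]big_nat [X in _ * X]big1; last first.
  by move=> b ?; apply: C2; nia.
rewrite mulr1 prodr_const_nat subn1 -exprM -[LHS]signr_odd oddM andbb.
by rewrite signr_odd.
Qed.

(** * Roots of unity and the Vandermonde product at powers of z *)

(** Evaluate X^s - 1 = prod (X - w^b) at 1/y and scale by (-y)^s, which is -y^s as s is odd. *)
Lemma prod_prim_root_sub1 (F : fieldType) (s : nat) (w y : F) :
  s.-primitive_root w -> odd s ->
  \prod_(0 <= b < s) (w ^+ b * y - 1) = y ^+ s - 1.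
Proof.
move=> w_prim s_odd; have s_gt0 := prim_order_gt0 w_prim.
have [->|y0] := eqVneq y 0.
  under eq_bigr do rewrite mulr0 sub0r.
  by rewrite prodr_const_nat subn0 -signr_odd s_odd expr0n gtn_eqF // sub0r.
have /(congr1 (fun P => P.[y^-1])) := factor_Xn_sub_1 w_prim.
rewrite horner_prod !hornerE => e.
have -> : y ^+ s - 1 = (- y) ^+ s * (y^-1 ^+ s - 1).
  by rewrite exprVn exprNn -signr_odd s_odd; field; rewrite expf_neq0.
rewrite -e -[s in _ ^+ s]subn0 -prodr_const_nat -big_split /=.
by apply: eq_bigr => b _; rewrite !hornerE; field.
Qed.

(* Raising to the power h = s * s is a quadratic character, trivial on powers
   of z; hence z ^+ j - z ^+ i may be replaced by z ^+ (j - i) - 1, and in the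
   resulting triangle only the even differences occur an odd number of times. *)
Lemma vandermonde_power (F : fieldType) (r : nat) (s := r.*2.+1) (z : F) :
    (s * s).-primitive_root z ->
    (forall x : F, x != 0 -> (x ^+ (s * s)) ^+ 2 = 1) ->
  (\prod_(0 <= j < s * s) \prod_(0 <= i < j) (z ^+ j.+1 - z ^+ i.+1)) ^+ (s * s)
    = (-1) ^+ r.
Proof.
move=> z_prim chi2; set h := (s * s)%N.
have h_odd : odd h by rewrite /h oddM /s /= odd_double.
have h_gt0 : (0 < h)%N by rewrite odd_gt0.
have zh : z ^+ h = 1 by apply: prim_expr_order.
have subz_neq0 d : ~~ (h %| d)%N -> z ^+ d - 1 != 0.
  by rewrite subr_eq0 (prim_order_dvd z_prim).
pose C d := (z ^+ d.*2 - 1) ^+ h.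
have C2 d : (0 < d < h)%N -> C d ^+ 2 = 1.
  move=> hd; apply/chi2/subz_neq0; rewrite -muln2 Gauss_dvdl ?coprimen2 //.
  by rewrite gtnNdvd; lia.
transitivity (\prod_(1 <= e < (r * r.+1).*2.+1) C e); last first.
  apply: prod_half_square => // [e he|a ha]; rewrite /C.
    rewrite -/h.
    have -> : z ^+ (h - e).*2 - 1 = - ((z ^+ (h - e).*2) * (z ^+ e.*2 - 1)).
      have e1 : z ^+ (h - e).*2 * z ^+ e.*2 = 1.
        rewrite -exprD -doubleD subnK; last by lia.
        by rewrite -muln2 exprM zh expr1n.
      by rewrite mulrBr mulr1 e1; ring.
    rewrite exprNn exprMn -signr_odd h_odd -exprM mulnC exprM zh expr1n.
    by ring.
  rewrite prodrXl; congr (_ ^+ _).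
  have w_prim : s.-primitive_root (z ^+ (s * 2)).
    have := exp_prim_root z_prim (s * 2).
    suff -> : (h %/ gcdn (s * 2) h = s)%N by [].
    rewrite -muln_gcdr gcdnC (eqP (_ : coprime s 2)) ?muln1 ?mulnK //.
    by rewrite coprimen2 /= odd_double.
  rewrite doubleMr mulnC exprM -(prod_prim_root_sub1 _ w_prim); last first.
    by rewrite /= odd_double.
  apply: eq_bigr => b _; congr (_ - _).
  by rewrite -exprM -exprD; congr (_ ^+ _); lia.
rewrite /C -(@prod_triangle_sqr1 _ (fun d => (z ^+ d - 1) ^+ h)); last first.
  move=> d hd; apply/chi2/subz_neq0; rewrite gtnNdvd // /h; nia.
have -> : (r * r.+1).*2.*2.+1 = h by rewrite /h /s; lia.
rewrite -prodrXl; apply: eq_bigr => j _.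
(* Reversing the inner product makes [i.+1] the difference of the two exponents. *)
rewrite -prodrXl big_nat_rev big_add1 /=; apply: eq_big_nat => i hi.
have -> : z ^+ j.+1 = z ^+ (0 + j - i.+1).+1 * z ^+ i.+1.
  by rewrite -exprD; congr (_ ^+ _); lia.
rewrite -[X in _ - X]mulr1 -mulrBr exprMn -[X in X * _ = _]exprM mulnC.
by rewrite exprM zh expr1n mul1r.
Qed.

(** * Factorials modulo p and the Vandermonde product at squares *)

Lemma fact_prod_sub (j : nat) :
  (j.+1 * \prod_(0 <= i < j) ((j - i) * (j.+1 + i.+1)) = (j.*2.+1)`!)%N.
Proof.
rewrite big_split /= mulnA.
have -> : (\prod_(0 <= i < j) (j - i) = j`!)%N.
  rewrite fact_prod big_add1 big_nat_rev /=; apply: eq_big_nat => i hi; lia.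
rewrite -factS.
suff H t : (j.+1`! * \prod_(0 <= i < t) (j.+1 + i.+1) = (j.+1 + t)`!)%N.
  by rewrite H; congr factorial; lia.
elim: t => [|t IHt]; first by rewrite big_geq // muln1 addn0.
by rewrite big_nat_recr //= mulnA IHt addnS factS mulnC.
Qed.

(** Wilson's theorem is the case t = 0; each further step replaces the factor p - 1 - t by t + 1,
    its negative modulo p. *)
Lemma fact_mul_fact_pchar (F : fieldType) (p t : nat) :
  p \in [pchar F] -> (t < p)%N -> (p.-1 - t)`!%:R * t`!%:R = (-1) ^+ t.+1 :> F.
Proof.
move=> pcharFp; have p_prime := pcharf_prime pcharFp.
have p0 : p%:R = 0 :> F by apply: pcharf0.
elim: t => [|t IHt] lt_tp.
  have := dvdn_pcharf pcharFp (p.-1)`!.+1.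
  rewrite -Wilson ?prime_gt1 // p_prime -addn1 natrD => /esym.
  by rewrite addr_eq0 subn0 fact0 mulr1 => /eqP.
have e : (p.-1 - t = (p.-1 - t.+1).+1)%N by lia.
rewrite exprS -IHt; last by lia.
rewrite e !factS -e !natrM.
have -> : (p.-1 - t)%:R = - t.+1%:R :> F.
  by apply/eqP; rewrite -addr_eq0 -natrD (_ : (_ + _)%N = p) ?p0 //; lia.
by ring.
Qed.

(* The product over i is (2j+1)! / (j+1); by Wilson the factorials at j and
   at h-1-j are mutually inverse, and the middle one is h!. *)
Lemma prod_sub_sqr_pchar (F : fieldType) (h : nat) :
    h.*2.+1 \in [pchar F] -> odd h ->
  \prod_(0 <= j < h) \prod_(0 <= i < j) (j.+1%:R ^+ 2 - i.+1%:R ^+ 2) = 1 :> F.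
Proof.
move=> pcharF h_odd; set D := LHS.
have h_neq0 : h`!%:R != 0 :> F.
  (* At t = h both factorials are h!, so the square of h! is a sign. *)
  apply: contra_eq_neq (fact_mul_fact_pchar pcharF (_ : (h < _)%N)); last first.
    by lia.
  by move=> ->; rewrite mulr0 eq_sym signr_eq0.
have hD : h`!%:R * D = \prod_(0 <= j < h) (j.*2.+1)`!%:R.
  rewrite fact_prod big_add1 natr_prod -big_split /=; apply: eq_big_nat => j hj.
  rewrite -fact_prod_sub natrM natr_prod; congr (_ * _).
  apply: eq_big_nat => i hi; rewrite natrM natrD natrB; last by lia.
  by rewrite -[j.+1]addn1 -[i.+1]addn1 !natrD; ring.
apply: (mulfI h_neq0); rewrite mulr1 hD.
set k := h./2; have hk : h = k.*2.+1 by rewrite -[LHS]odd_double_half h_odd.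
rewrite (@big_cat_nat _ _ _ k) //=; last by lia.
rewrite (@big_ltn _ _ _ k); last by lia.
rewrite -hk mulrCA -[k.+1]add0n big_addn.
have -> : (h - k.+1 = k)%N by lia.
rewrite [X in _ * (_ * X)]big_nat_rev -big_split /=.
rewrite big_nat big1 ?mulr1 // => j hj.
(* This t is 2(h - 1 - j) + 1, and p - 1 - t = 2j + 1; as t is odd, the pair multiplies to 1. *)
have := @fact_mul_fact_pchar _ _ (0 + k - j.+1 + k.+1).*2.+1 pcharF.
rewrite -signr_odd /= odd_double /= expr0 => e; rewrite -[RHS]e; last by lia.
by congr (_`!%:R * _)%R; lia.
Qed.

Lemma det_Vandermonde_nat (R : comNzRingType) (h : nat) (f : nat -> R) :
  \det (Vandermonde h (\row_(i < h) f i))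
    = \prod_(0 <= j < h) \prod_(0 <= i < j) (f j - f i).
Proof.
rewrite det_Vandermonde (exchange_big_dep predT) //= big_mkord.
apply: eq_bigr => j _; rewrite big_mkord.
rewrite (big_ord_widen h (fun i => f j - f i)) ?(ltnW (ltn_ord j)) //.
by apply: eq_bigr => i _; rewrite !mxE.
Qed.

(** * The permutation tau_g and its sign *)

Lemma tau_val_bounds (p : nat) (g : 'F_p) (b : nat) :
  prime p -> odd p -> g != 0 -> (0 < tau_val g b <= half p)%N.
Proof.
move=> p_prime p_odd g0; rewrite /tau_val /half.
have lt_p : (g ^+ b < p)%N by rewrite -[X in (_ < X)%N](Fp_cast p_prime).
have gt0 : (0 < (g ^+ b : 'F_p))%N.
  by rewrite lt0n; apply: contraNneq (expf_neq0 b g0) => e; apply/eqP/val_inj.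
move: (nat_of_ord _) lt_p gt0 => x lt_p gt0.
by case: ifP => ?; lia.
Qed.

Lemma tau_val_sqr (p : nat) (g : 'F_p) (b : nat) :
  prime p -> (tau_val g b)%:R ^+ 2 = (g ^+ 2) ^+ b :> 'F_p.
Proof.
move=> p_prime; rewrite exprAC /tau_val; case: ifP => _.
  by rewrite natr_Zp.
have lt_p : (g ^+ b < p)%N by rewrite -[X in (_ < X)%N](Fp_cast p_prime).
by rewrite natrB ?(ltnW lt_p) // pchar_Fp_0 // sub0r sqrrN natr_Zp.
Qed.

Lemma tau_funS (p : nat) (g : 'F_p) (i : 'I_(half p)) :
  prime p -> odd p -> g != 0 -> (tau_fun g i).+1 = tau_val g i.+1.
Proof.
move=> p_prime p_odd g0; have := tau_val_bounds i.+1 p_prime p_odd g0.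
by case/andP=> gt0 le; rewrite /= modn_small prednK.
Qed.

(** Squaring removes the choice of sign in tau_g, leaving g^(2b), which determines b modulo (p -
    1)/2. *)
Lemma tau_fun_inj (p : nat) (g : 'F_p) :
  prime p -> odd p -> p.-1.-primitive_root g -> injective (tau_fun g).
Proof.
move=> p_prime p_odd g_prim i j /(congr1 (fun x : 'I_ _ => x.+1)).
have g0 : g != 0.
  by rewrite (prim_root_eq0 g_prim) -lt0n (prim_order_gt0 g_prim).
rewrite !tau_funS // => /(congr1 (fun m => m%:R ^+ 2 : 'F_p)).
rewrite !tau_val_sqr // -!exprM => /eqP.
have := (ltn_ord i, ltn_ord j); rewrite (eq_prim_root_expr g_prim).
have -> : p.-1 = (2 * half p)%N by rewrite /half; lia.
case=> lt_i lt_j; rewrite -!muln_modr eqn_pmul2l // -[i.+1]addn1 -[j.+1]addn1.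
by rewrite eqn_modDr !modn_small // => /eqP/val_inj.
Qed.

Lemma tau_permE (p : nat) (g : 'F_p) :
  injective (tau_fun g) -> tau_perm g =1 tau_fun g.
Proof.
move=> /injectiveP inj i; rewrite /tau_perm.
(* The boolean is generalised together with its equation so that the dependent match can be analysed
   by cases. *)
suff H b (e : injectiveb (tau_fun g) = b) : b ->
  (match b as b return injectiveb (tau_fun g) = b -> {perm 'I_(half p)} with
   | true => fun H => perm (injectiveP _ H)
   | false => fun _ => 1%g
   end e) i = tau_fun g i by apply: H.
by case: b e => // e _; rewrite permE.
Qed.

Lemma odd_tau_perm (p r : nat) (g : 'F_p) :
    prime p -> p = (r.*2.+1 ^ 2).*2.+1 -> p.-1.-primitive_root g ->
  odd_perm (tau_perm g) = odd r.
Proof.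
move=> p_prime def_p g_prim; set s := r.*2.+1 in def_p.
have p_odd : odd p by rewrite def_p /= odd_double.
have tau_inj := tau_fun_inj p_prime p_odd g_prim.
have def_h : half p = (s * s)%N by rewrite /half def_p /= doubleK.
have h_odd : odd (half p) by rewrite def_h oddM /s /= odd_double.
have g0 : g != 0.
  by rewrite (prim_root_eq0 g_prim) -lt0n (prim_order_gt0 g_prim).
have pcharF := pchar_Fp p_prime.
pose v i : 'F_p := i.+1%:R ^+ 2.
pose w i : 'F_p := (g ^+ 2) ^+ i.+1.
have Ew : Vandermonde (half p) (\row_i w i)
    = col_perm (tau_perm g) (Vandermonde (half p) (\row_i v i)).
  apply/matrixP => i j; rewrite !mxE tau_permE // /v tau_funS //.
  by rewrite tau_val_sqr.
move/(congr1 determinant): Ew.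
rewrite col_permE det_mulmx det_perm odd_permV !det_Vandermonde_nat.
rewrite prod_sub_sqr_pchar //; last by move: pcharF; rewrite {1}def_p def_h.
rewrite mul1r => /(congr1 (fun x => x ^+ (s * s))).
rewrite {1}def_h vandermonde_power; first last.
- move=> x x0; rewrite -exprM; apply: (mulfI x0).
  have -> : (s * s * 2)%N = p.-1 by rewrite def_p /=; lia.
  rewrite -exprS prednK ?prime_gt0 // mulr1.
  by have := expf_card x; rewrite card_Fp.
- have := exp_prim_root g_prim 2.
  have -> : p.-1 = (s * s * 2)%N by rewrite def_p /=; lia.
  by rewrite gcdnMl mulnK.
rewrite -exprM mulnC exprM -[(-1) ^+ (s * s)]signr_odd -def_h h_odd => e.
(* The parity can be read off from the sign in ['F_p] only because -1 and 1 differ there. *)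
have m1_neq1 : -1 == 1 :> 'F_p = false.
  rewrite eq_sym -subr_eq0 opprK -(natrD _ 1 1) -(dvdn_pcharf pcharF).
  by rewrite gtnNdvd // odd_prime_gt2.
have e1 : (-1) ^+ (odd_perm (tau_perm g) (+) odd r) = 1 :> 'F_p.
  by rewrite signr_addb -e signr_odd -expr2 sqrr_sign.
by case: (odd_perm _) e1; case: (odd r) => //= /eqP; rewrite expr1 m1_neq1.
Qed.

Local Close Scope ring_scope.

(* sign (-1)^{|tau_g|} = (-1)^{n+1}  <=>  odd_perm tau_g = odd (n+1) *)
Theorem theorem1p1 (n : nat) (hn : 0 < n)
  (hp : prime (18 * (2 * n + 1) ^ 2 + 1))
  (g : 'F_(18 * (2 * n + 1) ^ 2 + 1))
  (hg : ((18 * (2 * n + 1) ^ 2)%N.-primitive_root g)%R) :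
  injective (tau_fun g) /\
  odd_perm (tau_perm g) = odd n.+1.
Proof.
have g_prim : ((18 * (2 * n + 1) ^ 2 + 1).-1.-primitive_root g)%R
  by rewrite (_ : _.-1 = 18 * (2 * n + 1) ^ 2)%N //; lia.
split; first by apply: tau_fun_inj => //; lia.
(* Here s = 3(2n + 1) = 2(3n + 1) + 1, and 3n + 1 has the parity of n + 1. *)
rewrite (@odd_tau_perm _ (3 * n + 1)) //; lia.
Qed.
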